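(* Let $\mathcal{I}_1$ be the set consisting of exactly one path of each length $n\ge 0$, $n\notin\{1,3\}$, namely $(UD)^{n/2}$ if $n$ is even, and $(UD)^{(n-5)/2}UUUDC_2$ if $n$ is odd. Let $\mathcal{I}$ be the union of $\mathcal{I}_1$ with the set of paths of the form $\alpha_1U^{k_1}C_{k_1}\alpha_2U^{k_2}C_{k_2}\cdots\alpha_rU^{k_r}C_{k_r}\alpha_{r+1}$ where $r\ge 1$, all $k_i$ are at least $2$, and all $\alpha_i$ ($1\le i\le r+1$) are in $\mathcal{I}_1$. The ordinary generating function $I(x)=\sum_{P\in\mathcal{I}}x^{|P|}$ of $\mathcal{I}$ with respect to the length is $$I(x)=\frac{x^5-2x^4+2x^3-2x^2+2x-1}{x^7-x^6+x^5-x^4+x^3-x^2+2x-1},$$ and its series expansion is $$1+x^2+x^3+2x^4+4x^5+5x^6+9x^7+15x^8+24x^9+40x^{10}+65x^{11}+O(x^{12}).$$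
   Context: Paths are lattice paths in the first quadrant ($y\ge 0$) starting at the origin and ending on the $x$-axis, written as words in the steps $U=(1,1)$, $D=(1,-1)$ and catastrophe steps $C_k=(1,-k)$, $k\ge 2$, where a catastrophe step must end on the $x$-axis (so $C_k$ can only be used from height $k$); these are called Dyck paths with catastrophes. The length $|P|$ is the number of steps of $P$; the empty path has length $0$. Generating functions are formal power series in $x$. *)

(* Defs.v *)
From HB Require Import structures.
From mathcomp Require Import all_boot all_order all_algebra.
From mathcomp Require Import mathcomp_extra boolp classical_sets functions.
From mathcomp Require Import cardinality fsbigop.

Set Implicit Arguments.
Unset Strict Implicit.
Unset Printing Implicit Defensive.
Import GRing.Theory.
Local Open Scope classical_set_scope.
Local Open Scope ring_scope.

(* The requirement k >= 2 on the steps [C k] is imposed by [dc_from] below. *)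
Inductive step : Type := U | D | C of nat.

Definition step_code (s : step) : option (option nat) :=
  match s with U => None | D => Some None | C k => Some (Some k) end.

Definition step_decode (o : option (option nat)) : step :=
  match o with None => U | Some None => D | Some (Some k) => C k end.

Lemma step_codeK : cancel step_code step_decode.
Proof. by case. Qed.

HB.instance Definition _ := Countable.copy step (can_type step_codeK).

(* [dc_from h w]: starting at height h, the word w stays weakly above the
   x-axis, ends on it, and uses C_k only for k >= 2 and from height k. *)
Fixpoint dc_from (h : nat) (w : seq step) : bool :=
  match w with
  | [::] => h == 0%N
  | U :: w' => dc_from h.+1 w'
  | D :: w' => (0 < h)%N && dc_from h.-1 w'
  | C k :: w' => [&& (2 <= k)%N, h == k & dc_from 0 w']
  end.

(* Dyck paths with catastrophes. *)
Definition dcpath : Type := {w : seq step | dc_from 0 w}.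

Definition len (P : dcpath) : nat := size (val P).

Definition UDpow (m : nat) : seq step := flatten (nseq m [:: U; D]).

(* Only used for n not in {1, 3}, so that n - 5 is not truncated for odd n. *)
Definition I1_word (n : nat) : seq step :=
  if odd n then UDpow (n - 5)./2 ++ [:: U; U; U; D; C 2] else UDpow n./2.

Definition I1 : set dcpath :=
  [set P | exists n : nat, n \notin [:: 1; 3]%N /\ val P = I1_word n].

(* The list s holds the pairs (alpha_i, k_i), 1 <= i <= r, and a is
   alpha_{r+1}. *)
Definition I2 : set dcpath :=
  [set P | exists (s : seq (dcpath * nat)) (a : dcpath),
    [/\ (1 <= size s)%N,
        forall p, p \in s -> I1 p.1 /\ (2 <= p.2)%N,
        I1 a &
        val P =
          flatten [seq val p.1 ++ nseq p.2 U ++ [:: C p.2] | p <- s] ++ val a]].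

Definition I : set dcpath := I1 `|` I2.

(* Formal power series, as coefficient sequences. *)
Section FormalPowerSeries.
Variable R : comUnitRingType.
Implicit Types f g : nat -> R.

Definition fps_of_poly (p : {poly R}) : nat -> R := fun n => p`_n.

Definition fps_mul f g : nat -> R := fun n => \sum_(i < n.+1) f i * g (n - i)%N.

(* The first n + 1 coefficients of the inverse g of f, from f g = 1, that is,
   g_0 = 1 / f_0 and g_(m+1) = - (f_1 g_m + ... + f_(m+1) g_0) / f_0. *)
Fixpoint fps_inv_seq f (n : nat) : seq R :=
  if n is m.+1 then
    let s := fps_inv_seq f m in
    rcons s (- (f 0%N)^-1 * \sum_(i < m.+1) f i.+1 * s`_(m - i))
  else [:: (f 0%N)^-1].

Definition fps_inv f : nat -> R := fun n => (fps_inv_seq f n)`_n.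

Definition fps_div f g : nat -> R := fps_mul f (fps_inv g).

(* f = g + O(x^m) *)
Definition fps_eqO (m : nat) f g : Prop := forall n, (n < m)%N -> f n = g n.

Lemma size_fps_inv_seq f n : size (fps_inv_seq f n) = n.+1.
Proof. by elim: n => //= n IHn; rewrite size_rcons IHn. Qed.

Lemma nth_fps_inv_seq f n i : (i <= n)%N -> (fps_inv_seq f n)`_i = fps_inv f i.
Proof.
elim: n => [|n IHn]; first by case: i.
rewrite leq_eqVlt => /predU1P[-> //|lt_in] /=.
by rewrite nth_rcons size_fps_inv_seq lt_in IHn.
Qed.

Lemma fps_mulV f : f 0%N \is a GRing.unit ->
  fps_mul f (fps_inv f) =1 fps_of_poly 1.
Proof.
move=> f0U [|n]; rewrite /fps_mul /fps_of_poly coef1 big_ord_recl.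
  by rewrite big_ord0 addr0 /fps_inv /= divrr.
rewrite subn0 {1}/fps_inv /= nth_rcons size_fps_inv_seq ltnn eqxx.
rewrite mulrA mulrN divrr // mulN1r addrC; apply/eqP; rewrite subr_eq0.
apply/eqP/eq_bigr => i _; rewrite /= /bump leq0n add1n subSS.
by rewrite nth_fps_inv_seq ?leq_subr.
Qed.

End FormalPowerSeries.

(* The coefficient of x^n in the sum of x^|P| over P in A. The finitely
   supported sum is 0 by convention if A has infinitely many paths of length
   n. *)
Definition ogf (A : set dcpath) : nat -> int :=
  fun n => \sum_(P \in A) ((len P == n)%:R : int).

(* Main.v *)
(* A path of I factors uniquely: after the maximal prefix (UD)^m, it either ends,
   continues with the suffix UUUD C_2 of an odd word of I_1, or reads U^k C_k
   with k >= 2, and these cases are told apart by what follows the leading U's.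
   Hence, with A = 1/(1-x) - x - x^3 and K = x^3/(1-x) the generating functions
   of I_1 and of the words U^k C_k, one has I = A + A K I.  Multiplying by
   (1-x)^2 gives the rational form; power series are handled as polynomials
   modulo x^N. *)

Require Import Defs.
From mathcomp Require Import all_boot all_order all_algebra.
From mathcomp Require Import mathcomp_extra boolp classical_sets functions.
From mathcomp Require Import cardinality fsbigop.
From mathcomp Require Import ring zify.

Set Implicit Arguments.
Unset Strict Implicit.
Unset Printing Implicit Defensive.
Import GRing.Theory.
Local Open Scope classical_set_scope.
Local Open Scope ring_scope.

(** * Concatenation products of graded languages *)

Section ConcatenationProduct.
Variable T : eqType.
Implicit Types A B : nat -> seq (seq T).

Definition graded A := forall n u, u \in A n -> size u = n.

Definition cat_lang A B (n : nat) : seq (seq T) :=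
  [seq p.1 ++ p.2 | i <- iota 0 n.+1,
                    p <- [seq (u, v) | u <- A i, v <- B (n - i)%N]].

Lemma mem_cat_langP A B n w :
  reflect (exists i u v, [/\ (i <= n)%N, u \in A i, v \in B (n - i)%N &
                             w = u ++ v])
          (w \in cat_lang A B n).
Proof.
apply: (iffP allpairsPdep) => [[i [[u v] [i_n /allpairsP[[u' v'] [/= uA vB]]]]]|].
  move=> [-> ->] ->; exists i, u', v'; split=> //.
  by move: i_n; rewrite mem_iota.
move=> [i [u [v [i_n uA vB ->]]]]; exists i, (u, v).
by rewrite mem_iota ltnS; split=> //; apply: allpairs_f.
Qed.

Lemma size_cat_lang (R : comUnitRingType) A B n :
  (size (cat_lang A B n))%:R =
    fps_mul (fun i => (size (A i))%:R : R) (fun i => (size (B i))%:R) n.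
Proof.
rewrite size_allpairs_dep sumnE big_map natr_sum /fps_mul.
rewrite -[n.+1 in LHS]subn0 -/(index_iota _ _) big_mkord.
by apply: eq_bigr => i _; rewrite size_allpairs natrM.
Qed.

(** It is enough that a word determines its first factor: by gradedness the size of that factor
    gives back the index, and cancellation gives the second factor. *)
Lemma uniq_cat_lang A B n :
  graded A -> (forall i, uniq (A i)) -> (forall i, uniq (B i)) ->
  (forall i j k l u u' v v', u \in A i -> u' \in A j -> v \in B k ->
     v' \in B l -> u ++ v = u' ++ v' -> u = u') ->
  uniq (cat_lang A B n).
Proof.
move=> gA uA uB inj; apply: allpairs_uniq_dep; first exact: iota_uniq.
  move=> i _; apply: allpairs_uniq => //.
  by move=> [? ?] [? ?] _ _ [-> ->].
move=> x y /allpairsPdep[i [p [_ /allpairsP[[u v] [uAi vB ->]] ->]]].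
case/allpairsPdep=> j [q [_ /allpairsP[[u' v'] [uAj vB' ->]] ->]].
rewrite /= in uAi vB uAj vB' * => e.
have eu := inj _ _ _ _ _ _ _ _ uAi uAj vB vB' e; subst u'.
move: e; have <- : i = j by rewrite -(gA _ _ uAi) (gA _ _ uAj).
by move/eqP; rewrite eqseq_cat // eqxx => /eqP ->.
Qed.

Lemma graded_cat_lang A B : graded A -> graded B -> graded (cat_lang A B).
Proof.
move=> gA gB n w /mem_cat_langP[i [u [v [i_n /gA su /gB sv ->]]]].
by rewrite size_cat su sv subnKC.
Qed.

End ConcatenationProduct.

(** * Building blocks of the paths *)

Lemma dc_from_cat h u v : dc_from h u -> dc_from 0 v -> dc_from h (u ++ v).
Proof.
elim: u h => [|[||k] u IHu] h /=; first by move=> /eqP ->.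
- exact: IHu.
- by case/andP=> -> /IHu{}IHu /IHu.
- by case/and3P=> -> -> /IHu{}IHu /IHu.
Qed.

Lemma dc_UDpow m : dc_from 0 (UDpow m).
Proof. by elim: m. Qed.

Lemma dc_I1_word n : dc_from 0 (I1_word n).
Proof.
rewrite /I1_word; case: ifP => _; last exact: dc_UDpow.
by apply: dc_from_cat => //; apply: dc_UDpow.
Qed.

Lemma dc_peak k : (2 <= k)%N -> dc_from 0 (nseq k U ++ [:: C k]).
Proof.
(* The starting height is generalised so that induction on the number of up steps goes through. *)
have H : forall m h, dc_from h (nseq m U ++ [:: C k]) =
                     (2 <= k)%N && (h + m == k)%N.
  by elim=> [|m IHm] h /=; rewrite ?addn0 ?andbT // IHm addSnnS.
by move=> k2; rewrite H k2 /=.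
Qed.

Lemma size_UDpow m : size (UDpow m) = m.*2.
Proof. by elim: m => //= m ->. Qed.

Lemma size_I1_word n : n \notin [:: 1; 3]%N -> size (I1_word n) = n.
Proof.
rewrite !inE /I1_word => n13; case: ifP => n_odd; last first.
  by rewrite size_UDpow; lia.
by rewrite size_cat size_UDpow /=; lia.
Qed.

(** The conditions on the tails make [m] and [m'] the maximal number of leading UD blocks, which the
    word determines. *)
Lemma UDpow_cat_inj m m' x x' : take 2 x != [:: U; D] ->
  take 2 x' != [:: U; D] -> UDpow m ++ x = UDpow m' ++ x' -> m = m' /\ x = x'.
Proof.
move=> hx hx'; elim: m m' => [|m IHm] [|m'] //=.
- by move=> e; move: hx; rewrite e /= take0.
- by move=> e; move: hx'; rewrite -e /= take0.
- by case=> /IHm [-> ->].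
Qed.

Lemma nseqU_cat_inj k k' c c' v v' :
  nseq k U ++ C c :: v = nseq k' U ++ C c' :: v' -> k = k'.
Proof. by elim: k k' => [|k IHk] [|k'] //= [] /IHk ->. Qed.

(** * Unambiguous enumeration of I by length *)

Definition lang1 n := if n \notin [:: 1; 3]%N then [:: I1_word n] else [::].

Definition peaks n := if (2 < n)%N then [:: nseq n.-1 U ++ [:: C n.-1]] else [::].

(* [f] is fuel: [langI f n] lists the words of length [n] only for [n < f]. *)
Fixpoint langI f n :=
  if f is f'.+1 then
    lang1 n ++ cat_lang lang1 (cat_lang peaks (langI f')) n
  else [::].

(** The grammar behind I = A + A K I: each rule application peels off one leading pair (alpha_1,
    k_1), and the base case supplies the final alpha. *)
Inductive Iword : seq step -> Prop :=
| Iword_base m of m \notin [:: 1; 3]%N : Iword (I1_word m)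
| Iword_cons m k w of m \notin [:: 1; 3]%N & (2 <= k)%N & Iword w :
    Iword (I1_word m ++ (nseq k U ++ [:: C k]) ++ w).

Lemma mem_lang1 n w : w \in lang1 n -> n \notin [:: 1; 3]%N /\ w = I1_word n.
Proof. by rewrite /lang1; case: ifP => // ?; rewrite inE => /eqP. Qed.

Lemma graded_lang1 : graded lang1.
Proof.
by move=> n u /mem_lang1[n13 ->]; exact: size_I1_word.
Qed.

Lemma graded_peaks : graded peaks.
Proof.
move=> n u; rewrite /peaks; case: ifP => // n2.
by rewrite inE => /eqP ->; rewrite size_cat size_nseq /=; lia.
Qed.

Lemma graded_langI f : graded (langI f).
Proof.
elim: f => [|f IHf] n u //=; rewrite mem_cat => /orP[/graded_lang1 //|].
apply: graded_cat_lang; first exact: graded_lang1.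
by apply: graded_cat_lang => //; exact: graded_peaks.
Qed.

Lemma langI_Iword f n w : w \in langI f n -> Iword w.
Proof.
elim: f n w => [|f IHf] n w //=; rewrite mem_cat => /orP[|].
  by case/mem_lang1=> ? ->; left.
case/mem_cat_langP=> i [u [v [_ /mem_lang1[i13 ->] + ->]]].
case/mem_cat_langP=> j [p [x [_ + /IHf xI ->]]].
rewrite /peaks; case: ifP => // j2; rewrite inE => /eqP ->.
by right=> //; lia.
Qed.

(** The fuel suffices because each peeling costs one unit of it and shortens the word by at least k
    + 1. *)
Lemma Iword_langI f w : Iword w -> (size w < f)%N -> w \in langI f (size w).
Proof.
move=> Iw; elim: Iw f => [m m13|m k x m13 k2 _ IHx] [|f] //=.
  by move=> _; rewrite mem_cat size_I1_word // /lang1 m13 inE eqxx.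
rewrite 3!size_cat size_nseq /= size_I1_word // mem_cat => lt_f.
apply/orP; right; apply/mem_cat_langP.
exists m, (I1_word m), ((nseq k U ++ [:: C k]) ++ x); split=> //.
- by lia.
- by rewrite /lang1 m13 inE.
apply/mem_cat_langP; exists k.+1, (nseq k U ++ [:: C k]), x; split=> //.
- by lia.
- by rewrite /peaks ltnS k2 inE.
have -> : (m + (k + 1 + size x) - m - k.+1 = size x)%N by lia.
by apply: IHx; lia.
Qed.

Lemma take_peak k v : (2 <= k)%N -> take 2 (nseq k U ++ C k :: v) != [:: U; D].
Proof. by case: k => [|[|k]]. Qed.

(** Once the maximal power of UD is removed, two words of equal parity have the same prefix; in the
    mixed case UUUD would have to agree with U^k C_k, and they differ within four letters. *)
Lemma I1_word_peak_inj i i' k k' v v' : (2 <= k)%N -> (2 <= k')%N ->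
  I1_word i ++ nseq k U ++ C k :: v = I1_word i' ++ nseq k' U ++ C k' :: v' ->
  I1_word i = I1_word i'.
Proof.
move=> k2 k2'; have tp := take_peak _ k2; have tp' := take_peak _ k2'.
rewrite /I1_word; case: ifP => _; case: ifP => _; rewrite -?catA;
  case/UDpow_cat_inj=> //.
- by move=> ->.
- by case: k' k2' {tp'} => [|[|[|[|k']]]].
- by case: k k2 {tp} => [|[|[|[|k]]]].
- by move=> ->.
Qed.

Lemma I1_word_neq_peak i i' k v : (2 <= k)%N ->
  I1_word i <> I1_word i' ++ nseq k U ++ C k :: v.
Proof.
move=> k2; have tp := take_peak _ k2.
(* The empty word plays the tail of the even word, so that [UDpow_cat_inj] covers all parities. *)
rewrite /I1_word -[UDpow i./2]cats0.
case: ifP => _; case: ifP => _; rewrite -?catA;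
  case/UDpow_cat_inj=> //; by case: k k2 {tp} => [|[|[|[|k]]]].
Qed.

Lemma uniq_lang1 n : uniq (lang1 n).
Proof. by rewrite /lang1; case: ifP. Qed.

Lemma uniq_peaks n : uniq (peaks n).
Proof. by rewrite /peaks; case: ifP. Qed.

Lemma mem_peaks_cat A n w : w \in cat_lang peaks A n ->
  exists k v, (2 <= k)%N /\ w = nseq k U ++ C k :: v.
Proof.
case/mem_cat_langP=> i [u [v [_ + _ ->]]]; rewrite /peaks.
case: ifP => // i2; rewrite inE => /eqP ->; exists i.-1, v.
by rewrite -catA; split=> //; lia.
Qed.

Lemma uniq_langI f n : uniq (langI f n).
Proof.
elim: f n => [|f IHf] n //=; rewrite cat_uniq uniq_lang1 /=; apply/andP; split.
  apply/hasPn => w /mem_cat_langP[i [u [v [_ /mem_lang1[_ ->]]]]].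
  case/mem_peaks_cat=> k [x [k2 ->]] ->; apply/negP => /mem_lang1[_] /esym.
  exact: I1_word_neq_peak.
apply: uniq_cat_lang; [exact: graded_lang1 | exact: uniq_lang1 | |].
  move=> i; apply: uniq_cat_lang => //; [exact: graded_peaks|exact: uniq_peaks|].
  move=> j j' l l' u u' v v'; rewrite /peaks.
  case: ifP => // _; rewrite inE => /eqP ->.
  case: ifP => // _; rewrite inE => /eqP -> _ _.
  by rewrite -!catA => /nseqU_cat_inj ->.
move=> i j k l u u' v v' /mem_lang1[_ ->] /mem_lang1[_ ->].
case/mem_peaks_cat=> m [x [m2 ->]] /mem_peaks_cat[m' [x' [m2' ->]]].
exact: I1_word_peak_inj.
Qed.

Lemma Iword_dc w : Iword w -> dc_from 0 w.
Proof.
elim=> [m _|m k x _ k2 _ IHx]; first exact: dc_I1_word.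
by apply: dc_from_cat; [exact: dc_I1_word|apply: dc_from_cat; first exact: dc_peak].
Qed.

Definition I1_path m : dcpath :=
  exist (fun w => is_true (dc_from 0 w)) (I1_word m) (dc_I1_word m).

Lemma I_Iword (P : dcpath) : I P <-> Iword (val P).
Proof.
split=> [[[n [n13 ->]]|[s [a [_ + [n [n13 ea]] ->]]]]|IP]; first by left.
  rewrite ea; elim: s => [|p s IHs] sI1 /=; first by left.
  have [[m [m13 ->]] p2] := sI1 p (mem_head _ _).
  have /IHs Iw q : q \in s -> I1 q.1 /\ (2 <= q.2)%N.
    by move=> qs; apply: sI1; rewrite inE qs orbT.
  by have := Iword_cons m13 p2 Iw; rewrite -!catA.
have I1P m : m \notin [:: 1; 3]%N -> I1 (I1_path m) by exists m.
(* Allowing the empty list gives a statement suited to induction; [s] empty then means [I1], and [s]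
   nonempty means [I2]. *)
suff [s [a [sI1 Ia eP]]] : exists (s : seq (dcpath * nat)) (a : dcpath),
    [/\ forall p, p \in s -> I1 p.1 /\ (2 <= p.2)%N, I1 a &
        val P = flatten [seq val p.1 ++ nseq p.2 U ++ [:: C p.2] | p <- s]
                ++ val a].
  case: s sI1 eP => [|p s] sI1 eP; last by right; exists (p :: s), a.
  by left; rewrite (_ : P = a) //; apply: val_inj.
elim: IP => [m m13|m k w m13 k2 _ [s [a [sI1 Ia ->]]]].
  by exists [::], (I1_path m); split=> //; apply: I1P.
exists ((I1_path m, k) :: s), a; split=> //.
  by move=> p; rewrite inE => /predU1P[->|/sI1 //]; split=> //; apply: I1P.
by rewrite /= -!catA.
Qed.

(** * From the enumeration to the recurrence for the coefficients *)

Lemma ogf_enum (A : set dcpath) n (s : seq (seq step)) : uniq s ->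
  (forall w, w \in s -> dc_from 0 w) ->
  (forall P : dcpath, val P \in s <-> A P /\ len P = n) ->
  finite_set (A `&` [set P | len P = n]) /\ ogf A n = (size s)%:R.
Proof.
move=> us dcs sA; pose t : seq dcpath := pmap insub s.
have mt P : (P \in t) = (val P \in s) by rewrite mem_pmap_sub.
have ut : uniq t by apply: pmap_sub_uniq.
have et : A `&` [set P | len P = n] = [set` t].
  by apply/seteqP; split=> P /=; rewrite mt => /sA.
split; first by rewrite et; exact: finite_seq.
(* The support of the summand is the finite set listed by [t], so the default value 0 for infinite
   support does not arise. *)
rewrite /ogf fsbig_supp (_ : _ `&` _ = [set` t]); last first.
  rewrite -et; apply/seteqP; split=> P [AP] /=; last by move=> ->; rewrite eqxx.
  by case: eqP.
rewrite -fsbig_seq // (eq_big_seq (fun=> 1)) => [|P]; last first.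
  by rewrite mt => /sA[_ ->]; rewrite eqxx.
rewrite big_const_seq count_predT iter_addr_0 /t size_pmap_sub.
by congr (_ *+ _); apply/eqP; rewrite -all_count; apply/allP.
Qed.

Lemma ogf_langI f n : (n < f)%N ->
  finite_set (I `&` [set P | len P = n]) /\ ogf I n = (size (langI f n))%:R.
Proof.
move=> n_f; apply: ogf_enum => [|w /langI_Iword/Iword_dc //|P].
  exact: uniq_langI.
split=> [Pf|[/I_Iword IP lenP]].
  have IP := langI_Iword Pf; by split; [apply/I_Iword|exact: graded_langI Pf].
by rewrite -lenP in n_f *; exact: Iword_langI.
Qed.

Definition ogf1 (n : nat) : int := (n \notin [:: 1; 3]%N)%:R.

Definition ogf_peaks (n : nat) : int := (2 < n)%N%:R.

Lemma ogf_rec n :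
  ogf I n = ogf1 n + fps_mul ogf1 (fps_mul ogf_peaks (ogf I)) n.
Proof.
have s1 i : (size (lang1 i))%:R = ogf1 i by rewrite /lang1 /ogf1; case: ifP.
have sp i : (size (peaks i))%:R = ogf_peaks i.
  by rewrite /peaks /ogf_peaks; case: ifP.
rewrite (ogf_langI (ltnSn n)).2 /= size_cat natrD s1 size_cat_lang.
congr (_ + _); apply: eq_bigr => i _; rewrite s1 size_cat_lang.
congr (_ * _); apply: eq_bigr => j _; rewrite sp /ogf_peaks.
(* The inner fuel is only [n], too little for words of length [n]; but [ogf_peaks j] vanishes unless
   j > 2, and then the remaining length is below [n]. *)
case: (ltnP 2 j) => j2; last by rewrite !mul0r.
have lt_n : (n - i - j < n)%N by have := ltn_ord j; lia.
by rewrite (ogf_langI lt_n).2.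
Qed.

(** * Power series modulo X^N and the rational form *)

Section PowerSeriesModXn.
Variable R : comUnitRingType.
Implicit Types (p q F G : {poly R}) (f g : nat -> R).

Lemma coefM_fps_mul F G f g n : (forall i, (i <= n)%N -> F`_i = f i) ->
  (forall i, (i <= n)%N -> G`_i = g i) -> (F * G)`_n = fps_mul f g n.
Proof.
move=> Ff Gg; rewrite coefM; apply: eq_bigr => i _.
by rewrite Ff ?Gg ?leq_subr // -ltnS.
Qed.

Lemma eq_coef_modXn N p q : (forall i, (i < N)%N -> p`_i = q`_i) ->
  exists r, p = q + r * 'X^N.
Proof.
move=> pq; exists (drop_poly N p - drop_poly N q).
rewrite -{1}(poly_take_drop N p) -{1}(poly_take_drop N q).
have -> : take_poly N p = take_poly N q.
  by apply/polyP => i; rewrite !coef_take_poly; case: ifP => // /pq.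
by ring.
Qed.

(** With V the truncated inverse of q, one has F = F q V = p V modulo X^N. *)
Lemma fps_divP p q F r N : q`_0 \is a GRing.unit -> F * q = p + r * 'X^N ->
  forall n, (n < N)%N -> F`_n = fps_div (fps_of_poly p) (fps_of_poly q) n.
Proof.
move=> q0U eF n n_N; pose V := \poly_(i < N) fps_inv (fps_of_poly q) i.
have [s qV] : exists s, q * V = 1 + s * 'X^N.
  apply: eq_coef_modXn => i i_N; rewrite -[RHS](fps_mulV q0U).
  apply: coefM_fps_mul => // j j_i; by rewrite coef_poly (leq_ltn_trans j_i).
have -> : F = p * V + (r * V - F * s) * 'X^N.
  transitivity (F * q * V - F * s * 'X^N); first by rewrite -mulrA qV; ring.
  by rewrite eF; ring.
rewrite coefD coefMXn n_N addr0; apply: coefM_fps_mul => // j j_n.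
by rewrite coef_poly (leq_ltn_trans j_n).
Qed.

End PowerSeriesModXn.

(** Here t stands for X^N, and the last term collects the truncation errors. Numerator and
    denominator are -(1-x) B and -((1-x)^2 - B x^3), where B = 1 - x + x^2 - x^3 + x^4 represents
    (1-x) A. *)
Lemma solve_ogf_system (R : comNzRingType) (x t a k g r1 r2 r3 : R) :
  g = a + a * (k * g) + r1 * t ->
  (1 - x) * a = 1 - x + x ^+ 2 - x ^+ 3 + x ^+ 4 + r2 * t ->
  (1 - x) * k = x ^+ 3 + r3 * t ->
  g * (x ^+ 7 - x ^+ 6 + x ^+ 5 - x ^+ 4 + x ^+ 3 - x ^+ 2 + 2 * x - 1) =
    x ^+ 5 - 2 * x ^+ 4 + 2 * x ^+ 3 - 2 * x ^+ 2 + 2 * x - 1 +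
    - ((1 - x) * r2
       + (1 - x + x ^+ 2 - x ^+ 3 + x ^+ 4 + r2 * t) * r3 * g
       + r2 * x ^+ 3 * g + (1 - x) ^+ 2 * r1) * t.
Proof.
move=> eg ea ek.
have e : (1 - x) ^+ 2 * g = (1 - x) * ((1 - x) * a)
    + ((1 - x) * a) * ((1 - x) * k) * g + (1 - x) ^+ 2 * r1 * t.
  by rewrite {1}eg; ring.
transitivity (- ((1 - x) ^+ 2 * g
    - (1 - x + x ^+ 2 - x ^+ 3 + x ^+ 4) * x ^+ 3 * g)); first by ring.
by rewrite e ea ek; ring.
Qed.

Lemma coefB1X (F : {poly int}) n :
  ((1 - 'X) * F)`_n = F`_n - (if n is m.+1 then F`_m else 0).
Proof. by rewrite mulrBl mul1r coefB coefXM; case: n. Qed.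

Local Notation num :=
  ('X^5 - 2 * 'X^4 + 2 * 'X^3 - 2 * 'X^2 + 2 * 'X - 1 : {poly int}).
Local Notation den :=
  ('X^7 - 'X^6 + 'X^5 - 'X^4 + 'X^3 - 'X^2 + 2 * 'X - 1 : {poly int}).

Lemma den0_unit : den`_0 \is a GRing.unit.
Proof. by rewrite -horner_coef0 !hornerE /=. Qed.

Lemma ogf_I_fps_div : ogf I =1 fps_div (fps_of_poly num) (fps_of_poly den).
Proof.
move=> n; pose N := n.+1.
pose tr (f : nat -> int) : {poly int} := \poly_(i < N) f i.
have trE f i j : (i <= j)%N -> (j < N)%N -> (tr f)`_i = f i.
  by move=> ij jN; rewrite coef_poly (leq_ltn_trans ij).
set A := tr ogf1; set K := tr ogf_peaks; set G := tr (ogf I).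
have [r1 eG] : exists r, G = A + A * (K * G) + r * 'X^N.
  apply: eq_coef_modXn => i iN; rewrite coefD !(trE _ i i) // ogf_rec.
  congr (_ + _); apply/esym/coefM_fps_mul => j ji; first exact: trE iN.
  by apply: coefM_fps_mul => l lj; apply: trE (leq_trans lj ji) iN.
have [r2 eA] : exists r,
    (1 - 'X) * A = (1 - 'X + 'X^2 - 'X^3 + 'X^4) + r * 'X^N.
  apply: eq_coef_modXn => i iN.
  rewrite coefB1X !(coefD, coefN, coefXn, coefX, coef1).
  case: i iN => [|i] iN; rewrite !(trE _ _ _ _ iN) //.
  (* From degree 5 on, consecutive coefficients of [A] are both 1 and cancel; lower degrees are
     computed. *)
  by case: i iN => [|[|[|[|i]]]].
have [r3 eK] : exists r, (1 - 'X) * K = 'X^3 + r * 'X^N.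
  apply: eq_coef_modXn => i iN; rewrite coefB1X coefXn.
  case: i iN => [|i] iN; rewrite !(trE _ _ _ _ iN) //.
  by case: i iN => [|[|[|[|i]]]].
rewrite -(trE (ogf I) n n) //.
exact: (fps_divP den0_unit (solve_ogf_system eG eA eK)).
Qed.

Theorem theorem3p6 :
  [/\ (forall n : nat, finite_set (I `&` [set P : dcpath | len P = n])),
      ogf I =1
        fps_div
          (fps_of_poly
             ('X^5 - 2 * 'X^4 + 2 * 'X^3 - 2 * 'X^2 + 2 * 'X - 1 : {poly int}))
          (fps_of_poly
             ('X^7 - 'X^6 + 'X^5 - 'X^4 + 'X^3 - 'X^2 + 2 * 'X - 1 :
                {poly int})) &
      fps_eqO 12 (ogf I)
        (fps_of_poly
           (1 + 'X^2 + 'X^3 + 2 * 'X^4 + 4 * 'X^5 + 5 * 'X^6 + 9 * 'X^7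
            + 15 * 'X^8 + 24 * 'X^9 + 40 * 'X^10 + 65 * 'X^11 : {poly int}))].
Proof.
split; [by move=> n; have [] := ogf_langI (ltnSn n) | exact: ogf_I_fps_div |].
move=> n n12; rewrite ogf_I_fps_div; symmetry; move: n n12.
(* The witness [r] is the quotient by X^12 of (expansion times denominator minus numerator). *)
apply: (fps_divP (N := 12) den0_unit (r := 107 - 38 * 'X + 43 * 'X^2
  - 34 * 'X^3 + 49 * 'X^4 - 25 * 'X^5 + 65 * 'X^6)).
ring.
Qed.
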